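(* Let $G$ be a group acting faithfully by permutations on an infinite set $\Omega$, and suppose that the action has no algebraicity. Let $r\ge 1$ and let $w=w(x_1,\dots,x_r)\in G*F_r$ be a regular word with constants in $G$. Then the set $$\{(g_1,\dots,g_r)\in G^r \mid w(g_1,\dots,g_r)\neq 1\}$$ is dense in $G^r$ with respect to the (product of the) topology of pointwise convergence on $G$ induced by the action on the discrete set $\Omega$. In particular, all mixed identities of $G$ are singular.
   Context: Words. $F_r$ is the free group on generators $x_1,\dots,x_r$. A word with constants in $G$ in $r$ variables is an element $w$ of the free product $G*F_r$. For $(g_1,\dots,g_r)\in G^r$, $w(g_1,\dots,g_r)\in G$ is the image of $w$ under the homomorphism $G*F_r\to G$ which is the identity on $G$ and sends $x_i$ to $g_i$. The word $w$ is a mixed identity of $G$ if $w(g_1,\dots,g_r)=1$ for all $(g_1,\dots,g_r)\in G^r$. Let $\mathrm{rk}\colon G*F_r\to F_r$ be the homomorphism sending every element of $G$ to $1$ and fixing $F_r$ pointwise. The word $w$ is singular if $\mathrm{rk}(w)=1$, and regular otherwise. Action. For finite $B\subseteq\Omega$, $G_B$ denotes the pointwise stabiliser of $B$ in $G$. The action has no algebraicity if for every finite $B\subseteq \Omega$ and every $a\in\Omega\setminus B$, the orbit $G_B\cdot a$ is infinite. Topology. The topology of pointwise convergence on $G$ has as a basis the sets $\{h\in G\mid h(\bar b)=\bar b'\}$, where $\bar b,\bar b'$ are finite tuples of elements of $\Omega$ of the same length (with $\Omega$ regarded as discrete); $G^r$ carries the product topology. *)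

(* Defs.v *)
From HB Require Import structures.
From mathcomp Require Import all_boot.
From mathcomp Require Import boolp classical_sets functions cardinality.
From mathcomp Require Import topology.

Set Implicit Arguments.
Unset Strict Implicit.
Unset Printing Implicit Defensive.

Local Open Scope quotient_scope.
Local Open Scope classical_set_scope.
Local Open Scope group_scope.

Section Congruence.
Variables (A : Type) (R : seq A -> seq A -> Prop).

(* The congruence on the free monoid [seq A] generated by [R]. *)
Inductive cong : seq A -> seq A -> Prop :=
| cong_rel u v s t : R s t -> cong (u ++ s ++ v) (u ++ t ++ v)
| cong_refl s : cong s s
| cong_sym s t : cong s t -> cong t s
| cong_trans s t u : cong s t -> cong t u -> cong s u.

Lemma cong_base s t : R s t -> cong s t.
Proof. by move=> /(cong_rel [::] [::]); rewrite /= !cats0. Qed.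

Lemma cong_ctx u v s t : cong s t -> cong (u ++ s ++ v) (u ++ t ++ v).
Proof.
elim=> {s t} [u' v' s t st|s|s t _|s t w _ + _].
- by have := cong_rel (u ++ u') (v' ++ v) st; rewrite -!catA.
- exact: cong_refl.
- exact: cong_sym.
- exact: cong_trans.
Qed.

Lemma cong_cat s s' t t' : cong s s' -> cong t t' -> cong (s ++ t) (s' ++ t').
Proof.
move=> ss' tt'; apply: (@cong_trans _ (s' ++ t)).
  exact: (cong_ctx [::] t ss').
by have := cong_ctx s' [::] tt'; rewrite !cats0.
Qed.

End Congruence.

(* A group presentation in monoid form: the inverse of each generator is the
   class of some generator. *)
Structure presentation := Presentation {
  letter : choiceType;
  linv : letter -> letter;
  lrel : seq letter -> seq letter -> Prop;
  linvK : involutive linv;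
  linvV : forall a, cong lrel [:: linv a; a] [::]
}.

Section PresentedGroup.
Variable P : presentation.
Notation L := (letter P).
Implicit Types s t : seq L.

Definition pcong : rel (seq L) := fun s t => `[< cong (@lrel P) s t >].

Lemma pcong_refl : reflexive pcong.
Proof. by move=> s; apply/asboolP/cong_refl. Qed.

Lemma pcong_sym : symmetric pcong.
Proof.
by move=> s t; apply/asboolP/asboolP; apply: cong_sym.
Qed.

Lemma pcong_trans : transitive pcong.
Proof.
by move=> t s u /asboolP st /asboolP tu; apply/asboolP; apply: cong_trans tu.
Qed.

Canonical pcong_equiv := EquivRel pcong pcong_refl pcong_sym pcong_trans.

Definition presented := {eq_quot pcong}.
HB.instance Definition _ := Choice.on presented.
HB.instance Definition _ := EqQuotient.on presented.

Definition pclass s : presented := \pi_presented s.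

Lemma pclassP s t : pclass s = pclass t <-> cong (@lrel P) s t.
Proof. by split=> [/eqquotP/asboolP|st]; last by apply/eqquotP/asboolP. Qed.

Lemma repr_pclass s : cong (@lrel P) (repr (pclass s)) s.
Proof. by apply/pclassP; rewrite /pclass reprK. Qed.

Definition sinv s := rev [seq linv a | a <- s].

Lemma sinvK : involutive sinv.
Proof.
by move=> s; rewrite /sinv map_rev revK -map_comp map_id_in// => a _ /=; rewrite linvK.
Qed.

Lemma cong_sinvV s : cong (@lrel P) (sinv s ++ s) [::].
Proof.
elim: s => [|a s IH]; first exact: cong_refl.
rewrite /sinv /= rev_cons -cats1 -catA.
apply: cong_trans IH.
exact: (cong_ctx (sinv s) s (linvV a)).
Qed.

Lemma cong_sinvK s : cong (@lrel P) (s ++ sinv s) [::].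
Proof. by rewrite -{1}[s]sinvK; apply: cong_sinvV. Qed.

Lemma cong_sinv s t : cong (@lrel P) s t -> cong (@lrel P) (sinv s) (sinv t).
Proof.
move=> st; apply: (@cong_trans _ _ _ (sinv s ++ t ++ sinv t)).
  rewrite -{1}[sinv s]cats0; apply: cong_cat (cong_refl _ _) _.
  exact/cong_sym/cong_sinvK.
rewrite catA -{2}[sinv t]cat0s; apply: cong_cat (cong_refl _ _).
apply: cong_trans (cong_sinvV s).
exact: cong_cat (cong_refl _ _) (cong_sym st).
Qed.

Definition pone : presented := pclass [::].
Definition pmul (x y : presented) : presented := pclass (repr x ++ repr y).
Definition pinv (x : presented) : presented := pclass (sinv (repr x)).

Lemma pmulE s t : pmul (pclass s) (pclass t) = pclass (s ++ t).
Proof. by apply/pclassP/cong_cat; apply: repr_pclass. Qed.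

Lemma pinvE s : pinv (pclass s) = pclass (sinv s).
Proof. by apply/pclassP/cong_sinv/repr_pclass. Qed.

Lemma pclassW (Q : presented -> Prop) : (forall s, Q (pclass s)) -> forall x, Q x.
Proof. exact: quotW. Qed.

Lemma pmulA : associative pmul.
Proof.
elim/pclassW=> s; elim/pclassW=> t; elim/pclassW=> u.
by rewrite !pmulE catA.
Qed.

Lemma pmul1g : left_id pone pmul.
Proof. by elim/pclassW=> s; rewrite pmulE. Qed.

Lemma pmulg1 : right_id pone pmul.
Proof. by elim/pclassW=> s; rewrite pmulE cats0. Qed.

Lemma pmulVg : left_inverse pone pinv pmul.
Proof. by elim/pclassW=> s; rewrite pinvE pmulE; apply/pclassP/cong_sinvV. Qed.

Lemma pmulgV : right_inverse pone pinv pmul.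
Proof. by elim/pclassW=> s; rewrite pinvE pmulE; apply/pclassP/cong_sinvK. Qed.

HB.instance Definition _ :=
  isGroup.Build presented pmulA pmul1g pmulg1 pmulVg pmulgV.

Lemma pclass_cat s t : pclass (s ++ t) = pclass s * pclass t.
Proof. by rewrite -pmulE. Qed.

Section Lift.
Variables (K : groupType) (f : L -> K).

Definition wprod s : K := \prod_(a <- s) f a.

Lemma wprod_cat s t : wprod (s ++ t) = wprod s * wprod t.
Proof. by rewrite /wprod big_cat. Qed.

Hypothesis fP : forall s t, lrel s t -> wprod s = wprod t.

Lemma wprod_cong s t : cong (@lrel P) s t -> wprod s = wprod t.
Proof.
elim=> {s t} [u v s t /fP st|//|s t _ ->//|s t u _ -> _ ->//].
by rewrite !wprod_cat st.
Qed.

Definition plift of (forall s t, lrel s t -> wprod s = wprod t) :=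
  fun x : presented => wprod (repr x).

Lemma pliftE s : plift fP (pclass s) = wprod s.
Proof. exact/wprod_cong/repr_pclass. Qed.

Lemma plift_morph : monoid_morphism (plift fP).
Proof.
split; first by rewrite pliftE /wprod big_nil.
elim/pclassW=> s; elim/pclassW=> t.
by rewrite -pclass_cat !pliftE wprod_cat.
Qed.

End Lift.

End PresentedGroup.
Arguments pclass {P} s.

Section FreeGroup.
Variable X : choiceType.

(* [(x, false)] stands for the generator [x] and [(x, true)] for its inverse. *)
Definition fg_linv (a : X * bool) := (a.1, ~~ a.2).

Variant fg_rel : seq (X * bool) -> seq (X * bool) -> Prop :=
| FgCancel a : fg_rel [:: fg_linv a; a] [::].

Lemma fg_linvK : involutive fg_linv.
Proof. by case=> x b; rewrite /fg_linv /= negbK. Qed.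

Lemma fg_linvV a : cong fg_rel [:: fg_linv a; a] [::].
Proof. exact/cong_base/FgCancel. Qed.

Definition fg_pres := Presentation fg_linvK fg_linvV.

Definition free_group := presented fg_pres.
HB.instance Definition _ := Group.on free_group.

Definition fg_gen (x : X) : free_group := @pclass fg_pres [:: (x, false)].

Section Lift.
Variables (K : groupType) (g : X -> K).

Definition fg_letter (a : X * bool) : K := if a.2 then (g a.1)^-1 else g a.1.

Lemma fg_letterP (s t : seq (letter fg_pres)) :
  lrel s t -> wprod (P := fg_pres) fg_letter s = wprod (P := fg_pres) fg_letter t.
Proof.
case=> -[x b]; rewrite /wprod !big_cons big_nil mulg1 /fg_letter /=.
by case: b; rewrite /= ?mulgV ?mulVg.
Qed.

Definition fg_lift : free_group -> K := plift fg_letterP.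

Lemma fg_lift_morph : monoid_morphism fg_lift.
Proof. exact: plift_morph. Qed.

HB.instance Definition _ :=
  isUMagmaMorphism.Build free_group K fg_lift fg_lift_morph.

Lemma fg_lift_gen x : fg_lift (fg_gen x) = g x.
Proof. by rewrite /fg_lift /fg_gen pliftE /wprod big_seq1. Qed.

End Lift.
End FreeGroup.

Section FreeProduct.
Variables G H : groupType.

Definition fp_linv (a : G + H) : G + H :=
  match a with inl g => inl g^-1 | inr h => inr h^-1 end.

Variant fp_rel : seq (G + H) -> seq (G + H) -> Prop :=
| FpOneL : fp_rel [:: inl 1] [::]
| FpOneR : fp_rel [:: inr 1] [::]
| FpMulL x y : fp_rel [:: inl x; inl y] [:: inl (x * y)]
| FpMulR x y : fp_rel [:: inr x; inr y] [:: inr (x * y)].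

Lemma fp_linvK : involutive fp_linv.
Proof. by case=> x; rewrite /fp_linv /= invgK. Qed.

Lemma fp_linvV a : cong fp_rel [:: fp_linv a; a] [::].
Proof.
case: a => x.
- apply: cong_trans (cong_base FpOneL); rewrite -(mulVg x).
  exact/cong_base/FpMulL.
- apply: cong_trans (cong_base FpOneR); rewrite -(mulVg x).
  exact/cong_base/FpMulR.
Qed.

Definition fp_pres := Presentation fp_linvK fp_linvV.

Definition free_product := presented fp_pres.
HB.instance Definition _ := Group.on free_product.

Definition fp_inl (x : G) : free_product := @pclass fp_pres [:: inl x].
Definition fp_inr (x : H) : free_product := @pclass fp_pres [:: inr x].

Lemma fp_inl_morph : monoid_morphism fp_inl.
Proof.
split; first exact/pclassP/cong_base/FpOneL.
move=> x y; rewrite /fp_inl -pclass_cat.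
exact/pclassP/cong_sym/cong_base/FpMulL.
Qed.

Lemma fp_inr_morph : monoid_morphism fp_inr.
Proof.
split; first exact/pclassP/cong_base/FpOneR.
move=> x y; rewrite /fp_inr -pclass_cat.
exact/pclassP/cong_sym/cong_base/FpMulR.
Qed.

HB.instance Definition _ :=
  isUMagmaMorphism.Build G free_product fp_inl fp_inl_morph.
HB.instance Definition _ :=
  isUMagmaMorphism.Build H free_product fp_inr fp_inr_morph.

Section Lift.
Variables (K : groupType) (f : UMagmaMorphism.type G K).
Variable h : UMagmaMorphism.type H K.

Definition fp_letter (a : G + H) : K :=
  match a with inl x => f x | inr y => h y end.

Lemma fp_letterP (s t : seq (letter fp_pres)) :
  lrel s t -> wprod (P := fp_pres) fp_letter s = wprod (P := fp_pres) fp_letter t.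
Proof.
by case=> [||x y|x y]; rewrite /wprod !big_cons big_nil !mulg1 /= ?gmulf1 ?gmulfM.
Qed.

Definition fp_lift : free_product -> K := plift fp_letterP.

Lemma fp_lift_morph : monoid_morphism fp_lift.
Proof. exact: plift_morph. Qed.

HB.instance Definition _ :=
  isUMagmaMorphism.Build free_product K fp_lift fp_lift_morph.

Lemma fp_lift_inl x : fp_lift (fp_inl x) = f x.
Proof. by rewrite /fp_lift /fp_inl pliftE /wprod big_seq1. Qed.

Lemma fp_lift_inr y : fp_lift (fp_inr y) = h y.
Proof. by rewrite /fp_lift /fp_inr pliftE /wprod big_seq1. Qed.

End Lift.
End FreeProduct.
Arguments fp_inl {G H} x.
Arguments fp_inr {G H} x.

Section Words.
Variables (G : groupType) (r : nat).

Definition word := free_product G (free_group 'I_r).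

Definition word_eval (w : word) (g : 'I_r -> G) : G := fp_lift idfun (fg_lift g) w.

Definition word_rk : word -> free_group 'I_r := fp_lift (@one_fun G _) idfun.

Definition singular_word (w : word) := word_rk w = 1.

Definition regular_word (w : word) := ~ singular_word w.

Definition mixed_identity (w : word) := forall g : 'I_r -> G, word_eval w g = 1.

End Words.

Structure group_action (G : groupType) (Omega : Type) := GroupAction {
  act :> G -> Omega -> Omega;
  act1 : forall a, act 1 a = a;
  actM : forall g h a, act (g * h) a = act g (act h a)
}.

Section Action.
Variables (G : groupType) (Omega : Type) (to : group_action G Omega).

Definition faithful_action := forall g, (forall a, to g a = a) -> g = 1.

Definition pointwise_stab (B : set Omega) : set G :=
  [set g | forall b, B b -> to g b = b].

Definition stab_orbit (B : set Omega) (a : Omega) : set Omega :=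
  [set to g a | g in pointwise_stab B].

Definition no_algebraicity := forall (B : set Omega) (a : Omega),
  finite_set B -> ~ B a -> infinite_set (stab_orbit B a).

Definition seq_pair : Type := seq Omega * seq Omega.
HB.instance Definition _ := gen_eqMixin seq_pair.
HB.instance Definition _ := gen_choiceMixin seq_pair.
HB.instance Definition _ := isPointed.Build seq_pair ([::], [::]).

(* Alias of [G] carrying the topology of pointwise convergence induced by the
   action; the action is a phantom argument used to select the topology. *)
Definition ptws_group of group_action G Omega : Type := G.

Definition ptws_base (b : seq_pair) : set (ptws_group to) :=
  [set h : G | map (to h) b.1 = b.2].

Definition same_length : set seq_pair :=
  [set b | size b.1 = size b.2].

Lemma ptws_base_cover : \bigcup_(b in same_length) ptws_base b = setT.
Proof. by apply/seteqP; split=> // h _; exists ([::], [::]). Qed.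

Lemma ptws_base_join b c h : same_length b -> same_length c ->
  ptws_base b h -> ptws_base c h ->
  exists d, [/\ same_length d, ptws_base d h
              & ptws_base d `<=` ptws_base b `&` ptws_base c].
Proof.
case: b c => [b b'] [c c']; rewrite /same_length /ptws_base /= => sb sc hb hc.
exists (b ++ c, b' ++ c'); split => /=; first by rewrite !size_cat sb sc.
  by rewrite map_cat hb hc.
move=> k /=; rewrite map_cat => kE; split.
  by have := congr1 (take (size b)) kE; rewrite take_size_cat ?size_map// sb take_size_cat.
by have := congr1 (drop (size b)) kE; rewrite drop_size_cat ?size_map// sb drop_size_cat.
Qed.

HB.instance Definition _ := Choice.copy (ptws_group to) G.
HB.instance Definition _ := isBaseTopological.Build (ptws_group to)
  ptws_base_cover ptws_base_join.

End Action.

(* Main.v *)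
From Stdlib Require List.
Require Import Defs.
From mathcomp Require Import all_boot.
From mathcomp Require Import boolp classical_sets functions cardinality.
From mathcomp Require Import topology.

Set Implicit Arguments.
Unset Strict Implicit.
Unset Printing Implicit Defensive.

Local Open Scope classical_set_scope.
Local Open Scope group_scope.

(* A word is applied to a base point letter by letter, from right to left, while
   only finitely many values of the [g_i] are committed. Every visited point
   carries a label in the free group: constants preserve labels and [x_i]
   multiplies them by [x_i] on the left. When a letter acts at a point where it
   is not yet committed, its value is chosen, in an infinite orbit, outside
   finitely many translates of the points visited so far; hence two visited
   points related by products of constants of the word always bear the same
   label. The last point is then labelled [rk w] if the first one is labelled
   [1], and so differs from it when the word is regular. *)

(** * Words read one letter at a time *)

Lemma fg_letter_linv (X : choiceType) (K : groupType) (g : X -> K) (x : X * bool) :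
  fg_letter g (fg_linv x) = (fg_letter g x)^-1.
Proof. by case: x => i []; rewrite /fg_letter /= ?invgK. Qed.

Section WordInd.
Context {G : groupType} {r : nat}.
Implicit Types (w : word G r) (x : 'I_r * bool).

Definition free_letter x : free_group 'I_r := fg_letter (@fg_gen _) x.

Lemma free_letterE x : free_letter x = @pclass (fg_pres 'I_r) [:: x].
Proof.
case: x => i [] //; rewrite /free_letter /fg_letter /= /fg_gen.
exact: (@pinvE (fg_pres 'I_r) [:: (i, false)]).
Qed.

(** Factors are appended on the right because the rightmost one acts first on a point; an element of
    the free group is split into its letters. *)
Lemma word_ind (Q : word G r -> Prop) :
  Q 1 ->
  (forall w c, Q w -> Q (w * fp_inl c)) ->
  (forall w x, Q w -> Q (w * fp_inr (free_letter x))) ->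
  forall w, Q w.
Proof.
move=> Q1 Qc Qx; elim/pclassW; elim/last_ind => // s [c|y] Qs.
  by rewrite -cats1 pclass_cat; apply: Qc.
rewrite -cats1 pclass_cat -[X in _ * X]/(fp_inr y).
move: (pclass s) Qs; elim/pclassW: y; elim => [|x u IH] w Qw.
  by rewrite -[pclass [::]]/(1 : free_group 'I_r) gmulf1 mulg1.
rewrite -cat1s pclass_cat -free_letterE gmulfM mulgA.
exact/IH/Qx.
Qed.

Lemma word_rk1 : word_rk (1 : word G r) = 1.
Proof. exact: (fp_lift_morph _ _).1. Qed.

Lemma word_rkM w w' : word_rk (w * w') = word_rk w * word_rk w'.
Proof. exact: (fp_lift_morph _ _).2. Qed.

Lemma word_rk_inl c : word_rk (fp_inl c : word G r) = 1.
Proof. exact: fp_lift_inl. Qed.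

Lemma word_rk_inr y : word_rk (fp_inr y : word G r) = y.
Proof. exact: fp_lift_inr. Qed.

Lemma word_eval1 g : word_eval (1 : word G r) g = 1.
Proof. exact: (fp_lift_morph _ _).1. Qed.

Lemma word_evalM w w' g : word_eval (w * w') g = word_eval w g * word_eval w' g.
Proof. exact: (fp_lift_morph _ _).2. Qed.

Lemma word_eval_inl c g : word_eval (fp_inl c : word G r) g = c.
Proof. exact: fp_lift_inl. Qed.

Lemma word_eval_letter x g :
  word_eval (fp_inr (free_letter x) : word G r) g = fg_letter g x.
Proof.
rewrite /word_eval fp_lift_inr /free_letter.
case: x => i []; rewrite /fg_letter /=; last exact: fg_lift_gen.
rewrite gmulfV; congr (_^-1); exact: fg_lift_gen.
Qed.

End WordInd.

(** * Finite commitments and their extension *)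

Section Tracking.
Context {G : groupType} {Omega : Type} (to : group_action G Omega) {r : nat}.
Hypothesis noalg : no_algebraicity to.
Implicit Types (g : 'I_r -> G) (x y : 'I_r * bool) (p q a : Omega).
Implicit Types (E : set ('I_r * Omega * Omega)) (Z : set Omega) (C : set G).
Implicit Types (L : set (Omega * free_group 'I_r)).

(* [E (i, p, q)] commits [g i] to send [p] to [q]; [dart E x p q] is the
   resulting commitment for the letter [x]. *)
Definition dart E x p q := if x.2 then E (x.1, q, p) else E (x.1, p, q).

Definition add_dart E x p q :=
  E `|` [set if x.2 then (x.1, q, p) else (x.1, p, q)].

Lemma dart_addE E x p q y p' q' : dart (add_dart E x p q) y p' q' <->
  [\/ dart E y p' q', [/\ y = x, p' = p & q' = q] |
      [/\ y = fg_linv x, p' = q & q' = p]].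
Proof.
case: x y => i [] [j []]; rewrite /dart /add_dart /fg_linv /=; split;
  try (case=> [H|[-> -> ->]]; by [constructor 1|constructor 2|constructor 3]);
  by case=> [H|[e -> ->]|[e -> ->]]; [left|case: e => // ->; right|
    case: e => // ->; right].
Qed.

Lemma dart_linv E x p q : dart E (fg_linv x) q p <-> dart E x p q.
Proof. by case: x => i []. Qed.

Definition realizes g E := forall x p q, dart E x p q -> to (fg_letter g x) p = q.

Lemma act_injV h p q : to h p = q -> to h^-1 q = p.
Proof. by move=> <-; rewrite -actM mulVg act1. Qed.

(** Replacing the value [h] of the letter by [h * k], with [k] fixing all committed sources of [x],
    keeps the commitments; no algebraicity lets [k] move [p] to infinitely many points. *)
Lemma extend_dart g E x p (bad : set Omega) :
  finite_set E -> realizes g E -> (forall q, ~ dart E x p q) ->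
  finite_set bad ->
  exists g' q, ~ bad q /\ realizes g' (add_dart E x p q).
Proof.
move=> finE gE px finbad; set h := fg_letter g x.
pose D := [set p' | exists q', dart E x p' q'].
have finD : finite_set D.
  apply: sub_finite_set (finite_image
    (fun e : 'I_r * Omega * Omega => if x.2 then e.2 else e.1.2) finE).
  move=> p' [q']; rewrite /dart; case: x.2 => Eq.
    by exists (x.1, q', p').
  by exists (x.1, p', q').
have Dp : ~ D p by case=> q; exact: px.
(* Otherwise the orbit of [p] would lie in the finite set [h^-1 bad]. *)
have [k [kD nbad]] : exists k, pointwise_stab to D k /\ ~ bad (to h (to k p)).
  apply: contrapT => /forallNP nk; apply: (noalg finD Dp).
  apply: sub_finite_set (finite_image (to h^-1) finbad).
  move=> _ [k kD <-]; exists (to h (to k p)); last exact: act_injV.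
  by apply: contrapT => nb; apply: (nk k).
pose g' j := if j == x.1 then (if x.2 then (h * k)^-1 else h * k) else g j.
have g'x : fg_letter g' x = h * k.
  by rewrite /fg_letter /g' eqxx; case: x.2; rewrite ?invgK.
have g'N y : y.1 != x.1 -> fg_letter g' y = fg_letter g y.
  by rewrite /fg_letter /g' => /negPf ->.
have xE p' q' : dart E x p' q' -> to (fg_letter g' x) p' = q'.
  move=> Epq; rewrite g'x actM (kD p'); last by exists q'.
  exact: gE Epq.
exists g', (to h (to k p)); split => // y p' q'.
case/dart_addE => [Epq|[-> -> ->]|[-> -> ->]].
- have [yx|/g'N ->] := eqVneq y.1 x.1; last exact: gE.
  have [yE|yE] : y = x \/ y = fg_linv x.
    by case: x y yx {Epq g'N g'x g' px h D finD Dp k kD nbad xE}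
      => i [] [j []] /= ->; [left|right|right|left].
  + by move: Epq; rewrite yE; exact: xE.
  + by move: Epq; rewrite yE fg_letter_linv => /dart_linv/xE/act_injV.
- by rewrite g'x actM.
- by rewrite fg_letter_linv; apply: act_injV; rewrite g'x actM.
Qed.

(** * Labelled points and tracking along a word *)

(* [Z] contains the endpoints of the commitments made in advance, which carry
   no label; both orientations of an edge are covered by the last clause. *)
Definition labelling Z C E L :=
  [/\ finite_set E, finite_set L,
      forall c d p q f f', C c -> C d -> L (p, f) -> L (q, f') ->
        to c p = to d q -> f = f',
      forall c p f, C c -> L (p, f) -> ~ Z (to c p) &
      forall x p q, dart E x p q ->
        Z p \/ exists f, L (p, f) /\ L (q, free_letter x * f)].

(** The quantification over all [E] and [L] allows both to grow during the induction on [w]. Only a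
    return to a point of the initial [L] is constrained. *)
Definition tracked Z C (w : word G r) := forall g E L a f,
  labelling Z C E L -> realizes g E -> L (a, f) ->
  exists g', realizes g' E /\
    forall f', L (to (word_eval w g') a, f') -> f' = word_rk w * f.

Lemma tracked1 Z : tracked Z [set 1] 1.
Proof.
move=> g E L a f [_ _ Lfun _ _] gE La; exists g; split=> // f'.
rewrite word_eval1 act1 word_rk1 mul1g => La'.
exact: (Lfun 1 1 a a).
Qed.

(** The point [to c a] inherits the label [f]. Its translates by [d] in [C] are those of [a] by
    [d * c], hence the enlargement of [C]. *)
Lemma tracked_const Z C w c : tracked Z C w ->
  tracked Z (C `|` [set d * c | d in C]) (w * fp_inl c).
Proof.
move=> trw g E L a f [finE finL Lfun LZ LE] gE La.
have [||g' [g'E g'w]] := trw g E (L `|` [set (to c a, f)]) (to c a) f _ gE.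
- split=> //.
  + by rewrite finite_setU; split=> //; exact: finite_set1.
  + have aux d d' q f' : C d -> C d' -> L (q, f') ->
        to d (to c a) = to d' q -> f = f'.
      move=> Cd Cd' Lq; rewrite -actM => e.
      by apply: (Lfun _ _ _ _ _ _ _ _ La Lq e); [right; exists d|left].
    move=> d d' p q f1 f2 Cd Cd' [Lp|[-> ->]] [Lq|[-> ->]] //.
    * by apply: (Lfun d d') Lp Lq; left.
    * by move=> /esym/(aux d' d p f1 Cd' Cd Lp).
    * exact: aux.
  + move=> d p f' Cd [Lp|[-> _]]; first by apply: LZ Lp; left.
    by rewrite -actM; apply: LZ La; right; exists d.
  + by move=> x p q /LE[|[f' [? ?]]]; [left|right; exists f'; split; left].
- by right.
- exists g'; split=> // f' La'.
  rewrite word_rkM word_rk_inl mulg1; apply: g'w; left.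
  by move: La'; rewrite word_evalM word_eval_inl actM.
Qed.

Lemma tracked_letter Z C w x : finite_set Z -> finite_set C -> C 1 ->
  tracked Z C w -> tracked Z C (w * fp_inr (free_letter x)).
Proof.
move=> finZ finC C1 trw g E L a f labL gE La.
have [finE finL Lfun LZ LE] := labL.
(* It is enough to commit one step from [a] to a labelled [b]: the rest of the word is then tracked
   from [b]. *)
suff [g' [b [E' [L' [lab' g'E' [EE' LL'] [xE' Lb]]]]]] :
    exists g' b E' L', [/\ labelling Z C E' L', realizes g' E',
      (forall y p q, dart E y p q -> dart E' y p q) /\ L `<=` L' &
      dart E' x a b /\ L' (b, free_letter x * f)].
  have [h [hE' hw]] := trw _ _ _ _ _ lab' g'E' Lb.
  exists h; split=> [y p q /EE'|f' /LL']; first exact: hE'.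
  rewrite word_evalM actM word_eval_letter (hE' _ _ _ xE') => /hw ->.
  by rewrite word_rkM word_rk_inr mulgA.
have [[b ab]|/forallNP nab] := pselect (exists b, dart E x a b).
  exists g, b, E, L; split=> //; split=> //.
  (* As [C] contains 1, the labelled point [a] is not in [Z], so the existing commitment already
     labels [b]. *)
  have [aZ|[f' [Lf' Lb]]] := LE _ _ _ ab.
    by case: (LZ 1 a f) => //; rewrite act1.
  by rewrite (Lfun 1 1 a a f f').
(* A new value must not be carried by [C] into [Z] or onto a [C]-translate of a labelled point. *)
pose bad := \bigcup_(c in C) (to c^-1 @`
  (Z `|` [set to d e.1 | d in C & e in L])).
have finbad : finite_set bad.
  apply: bigcup_finite => // c _; apply: finite_image.
  by rewrite finite_setU; split=> //; exact: finite_image2.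
have [g' [b [nbad g'E']]] := extend_dart finE gE nab finbad.
have badZ c : C c -> ~ Z (to c b).
  move=> Cc Zc; apply: nbad; exists c => //.
  by exists (to c b); [left|exact: act_injV].
have badL c d q f' : C c -> C d -> L (q, f') -> to c b <> to d q.
  move=> Cc Cd Lq cb; apply: nbad; exists c => //.
  exists (to c b); last exact: act_injV.
  by right; exists d => //; exists (q, f') => //=.
exists g', b, (add_dart E x a b), (L `|` [set (b, free_letter x * f)]).
split=> //; last by split; [apply/dart_addE; constructor 2|right].
- split.
  + by rewrite finite_setU; split=> //; exact: finite_set1.
  + by rewrite finite_setU; split=> //; exact: finite_set1.
  + move=> c d p q f1 f2 Cc Cd [Lp|[-> ->]] [Lq|[-> ->]] //.
    * exact: Lfun.
    * by move=> /esym/(badL _ _ _ _ Cd Cc Lp).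
    * by move=> /(badL _ _ _ _ Cc Cd Lq).
  + by move=> c p f' Cc [Lp|[-> _]]; [exact: LZ Lp|exact: badZ].
  + move=> y p q /dart_addE[/LE[|[f' [? ?]]]|[-> -> ->]|[-> -> ->]].
    * by left.
    * by right; exists f'; split; left.
    * by right; exists f; split; [left|right].
    * right; exists (free_letter x * f); split; [by right|left].
      by rewrite /free_letter fg_letter_linv mulKg.
- by split=> [y p q ?|]; [apply/dart_addE; constructor 1|left].
Qed.

(** [C] is fixed before the starting point, which can thus be chosen to avoid the translates of [Z]
    by inverses of elements of [C]. *)
Lemma tracked_word Z (w : word G r) : finite_set Z ->
  exists C, [/\ finite_set C, C 1 & tracked Z C w].
Proof.
move=> finZ; move: w.
apply: word_ind => [|w c [C [finC C1 trw]]|w x [C [finC C1 trw]]].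
- by exists [set 1]; split; [exact: finite_set1| |exact: tracked1].
- exists (C `|` [set d * c | d in C]); split; last exact: tracked_const.
    by rewrite finite_setU; split=> //; exact: finite_image.
  by left.
- by exists C; split=> //; exact: tracked_letter.
Qed.

(** * Nontrivial values of regular words near a given tuple *)

Lemma regular_word_neq1 (w : word G r) (u : 'I_r -> G) (B : set Omega) :
  infinite_set [set: Omega] -> finite_set B -> regular_word w ->
  exists g, (forall i p, B p -> to (g i) p = to (u i) p) /\ word_eval w g <> 1.
Proof.
move=> infOmega finB wreg.
(* Agreement with [u] on [B] is committed in advance, and [Z] collects the endpoints. *)
pose E : set ('I_r * Omega * Omega) := [set (i, p, to (u i) p) | i in setT & p in B].
pose Z := B `|` [set to (u i) p | i in setT & p in B].
have finI : finite_set [set: 'I_r] by exact: finite_finset.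
have finE : finite_set E by exact: finite_image2.
have finZ : finite_set Z.
  by rewrite finite_setU; split=> //; exact: finite_image2.
have [C [finC C1 trw]] := tracked_word w finZ.
have [a aZ] : exists a, ~ (\bigcup_(c in C) (to c^-1 @` Z)) a.
  apply: contrapT => /forallNP na; apply: infOmega.
  apply: (sub_finite_set (B := \bigcup_(c in C) (to c^-1 @` Z))).
    by move=> a _; apply: contrapT; exact: na.
  by apply: bigcup_finite => // c _; exact: finite_image.
have uE : realizes u E.
  move=> [i []] p q; rewrite /dart /fg_letter /= => -[j _ [p' _ [<- <- <-]]] //.
  by rewrite -actM mulVg act1.
have lab : labelling Z C E [set (a, 1)].
  split=> //.
  - by move=> c d p q f f' _ _ [_ ->] [_ ->].
  - move=> c p f Cc [-> _] Zca; apply: aZ; exists c => //.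
    by exists (to c a) => //; exact: act_injV.
  - move=> [i b] p q dpq; left; move: dpq.
    case: b; rewrite /dart /= => -[j _ [p' Bp' [_ p'E upE]]].
      by right; exists j => //; exists p'.
    by left; rewrite -p'E.
have [g [gE gw]] := trw u E _ a 1 lab uE erefl.
exists g; split=> [i p Bp|wg].
  apply: (gE (i, false)); rewrite /dart /=.
  by exists i => //; exists p.
(* If the value were 1, the word would return [a], labelled 1, to itself, forcing
   [word_rk w = 1]. *)
by have := gw 1; rewrite wg act1 mulg1 => /(_ erefl)/esym.
Qed.

(** * Neighbourhoods in the product topology *)

Lemma nbhs_ptws (u : {ptws 'I_r -> ptws_group to}) O : open O -> O u ->
  exists B : set Omega, finite_set B /\
    forall g : 'I_r -> G, (forall i p, B p -> to (g i) p = to (u i) p) -> O g.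
Proof.
move=> oO Ou.
pose agree (B : set Omega) : set {ptws 'I_r -> ptws_group to} :=
  [set g | forall i p, B p -> to (g i) p = to (u i) p].
(* Tuples agreeing with [u] on finite sets generate a filter; its convergence to [u] can be checked
   one coordinate at a time. *)
pose F := filter_from (@finite_set Omega) agree.
have FF : Filter F.
  apply: filter_from_filter; first by exists set0; exact: finite_set0.
  move=> B B' finB finB'; exists (B `|` B'); first by rewrite finite_setU.
  by move=> g gBB'; split=> i p Bp; apply: gBB'; [left|right].
have Fu : F --> u.
  apply/cvg_sup => i A; rewrite nbhsE => -[_ [[V oV <-] Vu] VA].
  case: oV Vu VA => D subD <- [[b b'] Db ub] VA.
  exists [set p | List.In p b].
    elim: b {Db ub} => [|p b IH]; first exact: finite_set0.
    apply: (@sub_finite_set _ _ ([set p] `|` [set q | List.In q b])).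
      by move=> q [->|]; [left|right].
    by rewrite finite_setU; split=> //; exact: finite_set1.
  move=> g gb; apply: VA; exists (b, b') => //.
  have {}ub : map (to (u i)) b = b' := ub.
  by rewrite -ub; apply: List.map_ext_in => p pb; exact: gb.
have [B finB BO] : F O by apply: (Fu O); apply: open_nbhs_nbhs; split.
by exists B; split=> // g gB; exact: BO.
Qed.

End Tracking.

Theorem theorem1 (G : groupType) (Omega : Type) (to : group_action G Omega)
    (infOmega : infinite_set [set: Omega])
    (faith : faithful_action to) (noalg : no_algebraicity to) :
  (forall (r : nat) (w : word G r), (1 <= r)%N -> regular_word w ->
     dense [set g : {ptws 'I_r -> ptws_group to} | word_eval w g <> 1]) /\
  (forall (r : nat) (w : word G r), mixed_identity w -> singular_word w).
Proof.
split=> [r w _ wreg O [u Ou] oO|r w wid].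
  have [B [finB BO]] := nbhs_ptws oO Ou.
  have [g [gB wg]] := regular_word_neq1 noalg u infOmega finB wreg.
  by exists g; split; [exact: BO|].
apply: contrapT => wreg.
(* With no prescribed values, a regular word still takes a value other than 1. *)
have [g [_ []]] :=
  regular_word_neq1 noalg (fun=> 1) infOmega (finite_set0 _) wreg.
exact: wid.
Qed.
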